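(* Let $\alpha>1$, $\beta>0$, $A_\circ>0$, $A_\circ'>0$, $\triangle>0$, $R_{\mathrm{x}}\ge\triangle$, $\lambda_{\mathrm{x}}>0$, $p_{\mathrm{I}}\in[0,1]$. Let $\mathbf{x}_{\mathrm{rx}}=x_{\mathrm{rx}}\mathbf{e}_{\mathrm{x}}$ with $x_{\mathrm{rx}}\in\mathbb{R}$, and let $\mathbf{x}_{\mathrm{tx}}=x_{\mathrm{tx}}\mathbf{e}_{\mathrm{x}}+y_{\mathrm{tx}}\mathbf{e}_{\mathrm{y}}$ with $x_{\mathrm{tx}},y_{\mathrm{tx}}\in\mathbb{R}$, $x_{\mathrm{tx}}y_{\mathrm{tx}}=0$ and $\mathbf{x}_{\mathrm{tx}}\neq\mathbf{x}_{\mathrm{rx}}$. With the urban path loss $\ell_{\mathrm{pl}}=\ell_{\mathrm{pl}}^{\mathrm{u}}$ (defined in the context), put $$\zeta_{\mathrm{u}}=\Bigl(A_\circ\beta/\ell_{\mathrm{pl}}^{\mathrm{u}}(\mathbf{x}_{\mathrm{tx}},\mathbf{x}_{\mathrm{rx}})\Bigr)^{1/\alpha}.$$ Then the quantity $\mathcal{P}_\circ(\Phi_{\mathrm{x}})$ (defined in the context) satisfies $$\mathcal{P}_\circ(\Phi_{\mathrm{x}})=\exp\bigl(-p_{\mathrm{I}}\lambda_{\mathrm{x}}\zeta_{\mathrm{u}}\,\mathcal{X}(R_{\mathrm{x}})\bigr),$$ where $$\mathcal{X}(R_{\mathrm{x}})=g_\circ\Bigl(\alpha,\tfrac{R_{\mathrm{x}}+\|\mathbf{x}_{\mathrm{rx}}\|}{\zeta_{\mathrm{u}}}\Bigr)+g_\circ\Bigl(\alpha,\tfrac{R_{\mathrm{x}}-\|\mathbf{x}_{\mathrm{rx}}\|}{\zeta_{\mathrm{u}}}\Bigr)\mathbf{1}_{\|\mathbf{x}_{\mathrm{rx}}\|\le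 R_{\mathrm{x}}}-g_\circ\Bigl(\alpha,-\tfrac{R_{\mathrm{x}}-\|\mathbf{x}_{\mathrm{rx}}\|}{\zeta_{\mathrm{u}}}\Bigr)\mathbf{1}_{\|\mathbf{x}_{\mathrm{rx}}\|>R_{\mathrm{x}}}.$$
   Context: Notation: $\mathbf{e}_{\mathrm{x}}=[1\ 0]^{\mathrm T}$, $\mathbf{e}_{\mathrm{y}}=[0\ 1]^{\mathrm T}$; $\|\cdot\|$ is the Euclidean norm on $\mathbb{R}^2$; $\mathbf{1}_{\mathsf Q}=1$ if statement $\mathsf Q$ is true and $0$ otherwise (a term multiplied by a vanishing indicator is read as $0$). Urban path loss: for a receiver $\mathbf{x}_{\mathrm{rx}}$ on the horizontal road and a point $\mathbf{x}\ne\mathbf{x}_{\mathrm{rx}}$ on one of the two roads (coordinate axes), (i) if $\mathbf{x}=y\mathbf{e}_{\mathrm{y}}$ is on the vertical road and $\min(|y|,\|\mathbf{x}_{\mathrm{rx}}\|)>\triangle$, then $\ell_{\mathrm{pl}}^{\mathrm{u}}(\mathbf{x},\mathbf{x}_{\mathrm{rx}})=A_\circ'(\|\mathbf{x}\|\cdot\|\mathbf{x}_{\mathrm{rx}}\|)^{-\alpha}$; (ii) if $\mathbf{x}=y\mathbf{e}_{\mathrm{y}}$ is on the vertical road and $\min(|y|,\|\mathbf{x}_{\mathrm{rx}}\|)\le\triangle$, then $\ell_{\mathrm{pl}}^{\mathrm{u}}(\mathbf{x},\mathbf{x}_{\mathrm{rx}})=A_\circ(\|\mathbf{x}\|+\|\mathbf{x}_{\mathrm{rx}}\|)^{-\alpha}$;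 (iii) if $\mathbf{x}=x\mathbf{e}_{\mathrm{x}}$ is on the horizontal road, then $\ell_{\mathrm{pl}}^{\mathrm{u}}(\mathbf{x},\mathbf{x}_{\mathrm{rx}})=A_\circ\|\mathbf{x}_{\mathrm{rx}}-\mathbf{x}\|^{-\alpha}$. (At $\mathbf{x}=\mathbf{0}$, cases (ii) and (iii) agree.) Interferers: $\Phi_{\mathrm{x}}$ is the set of random points $x\mathbf{e}_{\mathrm{x}}$ on the horizontal road, where the coordinates $x$ form a homogeneous Poisson point process of intensity $p_{\mathrm{I}}\lambda_{\mathrm{x}}$ on $\mathcal{B}_{\mathrm{x}}=\{x\in\mathbb{R}: |x|\le R_{\mathrm{x}}\}$. To each point $\mathbf{x}\in\Phi_{\mathrm{x}}$ is attached a fading variable $\ell_{\mathrm{f}}(\mathbf{x})$; these are i.i.d. exponential of mean $1$ and independent of $\Phi_{\mathrm{x}}$. The normalized aggregate interference is $I(\Phi_{\mathrm{x}})=\sum_{\mathbf{x}\in\Phi_{\mathrm{x}}}\ell_{\mathrm{f}}(\mathbf{x})\,\ell_{\mathrm{pl}}(\mathbf{x},\mathbf{x}_{\mathrm{rx}})$. Definition: $\mathcal{P}_\circ(\Phi_{\mathrm{x}})=\mathbb{E}\{\exp(-\beta' I(\Phi_{\mathrm{x}}))\}$, where $\beta'=\beta/\ell_{\mathrm{pl}}(\mathbf{x}_{\mathrm{tx}},\mathbf{x}_{\mathrm{rx}})$. The function $g_\circ$: for $\alpha>0$ and $\vartheta\ge 0$, $g_\circ(\alpha,\vartheta)=\int_0^{\vartheta}\frac{\mathrm{d}u}{1+u^{\alpha}}=\vartheta\,{}_2F_1\bigl(1,\tfrac1\alpha;1+\tfrac1\alpha;-\vartheta^{\alpha}\bigr)$,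 with ${}_2F_1$ the Gauss hypergeometric function. *)

(* Defs.v *)
From mathcomp Require Import all_boot all_order all_algebra.
From mathcomp Require Import all_classical all_reals all_analysis.

Set Implicit Arguments.
Unset Strict Implicit.
Unset Printing Implicit Defensive.

Import Order.TTheory GRing.Theory Num.Theory.
Import numFieldNormedType.Exports.

Local Open Scope classical_set_scope.
Local Open Scope ring_scope.

Section plane.
Context {R : realType}.

Definition e_x : 'cV[R]_2 := delta_mx 0 0.
Definition e_y : 'cV[R]_2 := delta_mx 1 0.

(* The norm that the library puts on matrices is the sup norm. *)
Definition enorm (v : 'cV[R]_2) : R := Num.sqrt (\sum_i v i 0 ^+ 2).

(* A transmitter at x, on the union of the two coordinate axes, and a receiver
   xrx != x on the horizontal axis; other arguments give junk values. The
   origin is handled as a point of the vertical road, where the third formula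
   gives the same value. *)
Definition urban_path_loss (alpha A A' Delta : R) (x xrx : 'cV[R]_2) : R :=
  if x 0 0 == 0 then
    if Delta < Num.min `|x 1 0| (enorm xrx)
    then A' * (enorm x * enorm xrx) `^ (- alpha)
    else A * (enorm x + enorm xrx) `^ (- alpha)
  else A * enorm (xrx - x) `^ (- alpha).

(* Meant for theta >= 0; for theta < 0 the domain is empty and the value 0. *)
Definition g_circ (alpha theta : R) : R :=
  Rintegral (@lebesgue_measure R) `[0, theta] (fun u => (1 + u `^ alpha)^-1).

Definition calX (alpha zeta : R) (xrx : 'cV[R]_2) (r : R) : R :=
  g_circ alpha ((r + enorm xrx) / zeta)
  + g_circ alpha ((r - enorm xrx) / zeta) * (enorm xrx <= r)%R%:R
  - g_circ alpha (- ((r - enorm xrx) / zeta)) * (r < enorm xrx)%R%:R.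

End plane.

Section independence.
Context {d : measure_display} {T : measurableType d} {R : realType}.
Variable P : probability T R.

Definition mutually_independent (I : eqType) (G : I -> set_system T) : Prop :=
  forall (J : seq I) (E : I -> set T), uniq J ->
    (forall i, i \in J -> G i (E i)) ->
    P (\bigcap_(i in [set` J]) E i) = (\prod_(i <- J) P (E i))%E.

Definition independent_systems (G H : set_system T) : Prop :=
  forall E F, G E -> H F -> P (E `&` F) = (P E * P F)%E.

(* The events {f \in B} with B measurable. *)
Definition sigma_of {d' : measure_display} {T' : measurableType d'}
    (f : T -> T') : set_system T :=
  preimage_set_system setT f measurable.

End independence.

(* A finite point process on the line is given by its number of points N and by
   a measurable enumeration X of them: its points are X 0, ..., X (N - 1), and
   the later values of X are irrelevant. The order of enumeration is
   arbitrary. *)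
Section point_process.
Context {d : measure_display} {T : measurableType d} {R : realType}.
Variables (P : probability T R) (N : {RV P >-> nat}) (X : nat -> {RV P >-> R}).

Definition count_in (B : set R) (w : T) : nat :=
  (\sum_(i < N w) (X i w \in B))%N.

(* Homogeneous Poisson point process of intensity lam on [-r, r]. Taking B to be
   the complement of the window, almost surely all the points lie in it. The nat
   argument of poisson_prob is not used, and poisson_prob 0 is the Dirac mass
   at 0. *)
Definition homogeneous_PPP (lam r : R) : Prop :=
  (forall B : set R, measurable B -> forall U : set nat,
     P (count_in B @^-1` U)
     = poisson_prob
         (lam * fine (lebesgue_measure (B `&` [set` `[- r, r]%R]))) 0%N U) /\
  (forall (n : nat) (B : 'I_n -> set R),
     (forall i, measurable (B i)) -> trivIset setT B ->
     mutually_independent P (fun i => sigma_of (count_in (B i)))).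

(* Unit-mean exponential i.i.d. marks, F i being attached to the point X i.
   They are independent of the whole enumerated process (N, X): independence of
   the unordered set of points alone would allow an enumeration that
   correlates marks and locations. *)
Definition iid_exp_marks (F : nat -> {RV P >-> R}) : Prop :=
  [/\ forall i (V : set R), measurable V ->
        distribution P (F i) V = exponential_prob 1 V,
      mutually_independent P (fun i => sigma_of (F i))
    & independent_systems P
        <<s sigma_of N `|` \bigcup_i sigma_of (X i) >>
        <<s \bigcup_i sigma_of (F i) >>].

Definition interference (F : nat -> {RV P >-> R})
    (lpl : 'cV[R]_2 -> 'cV[R]_2 -> R) (xrx : 'cV[R]_2) (w : T) : R :=
  \sum_(i < N w) F i w * lpl (X i w *: e_x) xrx.

Definition P_circ (beta : R) (F : nat -> {RV P >-> R})
    (lpl : 'cV[R]_2 -> 'cV[R]_2 -> R) (xtx xrx : 'cV[R]_2) : \bar R :=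
  let beta' := beta / lpl xtx xrx in
  ('E_P[fun w => expR (- beta' * interference F lpl xrx w)])%E.

End point_process.

(* Main.v *)
(** By independence and Tonelli, the marks can be integrated out first: a mark
    with unit exponential law contributes the factor 1 / (1 + s(x)) at a point
    x, where s = beta' * l_pl, so the transform becomes the expectation of
    prod_i (1 - psi(X_i)) with psi = s / (1 + s). When psi is a simple function
    this product is prod_j (1 - t_j) ^ N(B_j) for finitely many disjoint sets
    B_j, and the Poisson law of the counts with their independence give
    exp (- lambda * int psi); the general case follows by monotone
    approximation of psi. Finally psi(x) = 1 / (1 + (|x - x_rx| / zeta)^alpha)
    off x_rx, and the substitution u = (x - x_rx) / zeta turns int psi into
    zeta * X(R_x). *)

Require Import Defs.
From mathcomp Require Import all_boot all_order all_algebra.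
From mathcomp Require Import all_classical all_reals all_analysis.
From mathcomp Require Import measurable_realfun.
From mathcomp Require Import ring lra.

Set Implicit Arguments.
Unset Strict Implicit.
Unset Printing Implicit Defensive.

Import Order.TTheory GRing.Theory Num.Theory.
Import numFieldNormedType.Exports.

Local Open Scope classical_set_scope.
Local Open Scope ring_scope.

(** * Integration against a weight *)

Section weighted.
Context d d' (T : measurableType d) (T' : measurableType d') (R : realType).
Local Open Scope ereal_scope.
Import HBNNSimple.

(** The hypothesis is the case of an indicator; linearity gives simple functions and monotone
    convergence the rest. The weight [Z] will be either a density, with [f] the identity, or a
    product of the other factors in an induction over independent variables. *)
Lemma ge0_integral_weighted (mu : {measure set T -> \bar R})
    (nu : {measure set T' -> \bar R}) (f : T -> T') (Z : T -> R)
    (h : T' -> \bar R) :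
  measurable_fun setT f -> measurable_fun setT Z -> (forall x, 0 <= Z x)%R ->
  measurable_fun setT h -> (forall y, 0 <= h y) ->
  (forall B, measurable B -> \int[mu]_(x in f @^-1` B) (Z x)%:E = nu B) ->
  \int[mu]_x ((Z x)%:E * h (f x)) = \int[nu]_y h y.
Proof.
move=> mf mZ Z0 mh h0 Znu.
pose g := nnsfun_approx measurableT mh.
have cg y : EFin \o g^~ y @ \oo --> h y by apply: cvg_nnsfun_approx.
have mpre B : measurable B -> measurable (f @^-1` B).
  by move=> mB; rewrite -[_ @^-1` _]setTI; exact: mf.
transitivity (limn (fun n => \int[nu]_y (g n y)%:E)); last first.
  rewrite -monotone_convergence//.
  - by apply: eq_integral => y _; apply/cvg_lim => //; exact: cg.
  - by move=> n; exact/measurable_EFinP/measurable_funP.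
  - by move=> n y _; rewrite lee_fin.
  - by move=> y _ m n mn; rewrite lee_fin; exact/lefP/nd_nnsfun_approx.
transitivity (limn (fun n => \int[mu]_x ((Z x)%:E * (g n (f x))%:E))).
  have g0 x : {homo (fun n => (g n (f x))%:E) : m n / (m <= n)%N >-> m <= n}.
    by move=> m n mn; rewrite lee_fin; exact/lefP/nd_nnsfun_approx.
  rewrite -monotone_convergence//=.
  - apply: eq_integral => x _; apply/esym/cvg_lim => //.
    by apply: cvgeZl => //; exact: cg.
  - move=> n; apply: emeasurable_funM; first exact/measurable_EFinP.
    apply/measurable_EFinP; exact: measurableT_comp.
  - by move=> n x _; rewrite mule_ge0// lee_fin.
  - by move=> x _ m n mn; rewrite lee_wpmul2l ?lee_fin//; exact: g0.
apply: congr_lim; apply/funext => n.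
have m1 r : measurable (g n @^-1` [set r]) by exact: measurable_funPTI.
(* The simple function [g n] is split along its fibres, and the hypothesis is applied to each
   fibre. *)
transitivity (\int[mu]_x (\sum_(r \in range (g n))
    ((Z x)%:E * (r * \1_(g n @^-1` [set r]) (f x))%:E))).
  apply: eq_integral => x _.
  by rewrite -ge0_mule_fsumr => [|y]; [rewrite fsumEFin// -fimfunE|
    exact: nnfun_muleindic_ge0].
transitivity (\int[nu]_y (\sum_(r \in range (g n))
    (r * \1_(g n @^-1` [set r]) y)%:E)); last first.
  by apply: eq_integral => y _; rewrite [in RHS]fimfunE -fsumEFin.
have mi r : measurable_fun setT (fun y => (r * \1_(g n @^-1` [set r]) y)%:E).
  by apply/measurable_EFinP; exact: measurable_funM.
rewrite !ge0_integral_fsum//.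
- apply: eq_fsbigr => r /set_mem[y _ ry].
  have r0 : (0 <= r)%R by rewrite -ry.
  under [RHS]eq_integral do rewrite EFinM.
  rewrite ge0_integralZl//; last exact/measurable_EFinP.
  rewrite integral_indic// setIT -Znu//.
  rewrite [in RHS]integral_mkcond -ge0_integralZl//.
  - by apply: eq_integral => x _; rewrite epatch_indic/= muleCA -EFinM.
  - apply/(measurable_restrictT _ (mpre _ (m1 r))).
    by apply: measurable_funTS; exact/measurable_EFinP.
  - by move=> x _; apply: erestrict_ge0 => ? _; rewrite lee_fin.
- by move=> r x _; rewrite nnfun_muleindic_ge0.
- move=> r; apply: emeasurable_funM; first exact/measurable_EFinP.
  exact: measurableT_comp (mi r) mf.
- move=> r x _; apply: mule_ge0; rewrite ?lee_fin//.
  exact: nnfun_muleindic_ge0.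
Qed.
End weighted.

(** * Products over independent variables *)

Section independence.
Context d d' (T : measurableType d) (T' : measurableType d') (R : realType).
Variables (P : probability T R) (I : eqType) (f : I -> {mfun T >-> T'}).
Local Open Scope ereal_scope.

(** Lifts independence from events to nonnegative functions. It serves twice: for the counts in
    disjoint sets, and for the marks once the points are fixed. *)
Lemma ge0_integral_prod (h : I -> T' -> R) (e : I -> R) :
  mutually_independent P (fun i => sigma_of (f i)) ->
  (forall i, measurable_fun setT (h i)) -> (forall i y, 0 <= h i y)%R ->
  (forall i, \int[P]_w (h i (f i w))%:E = (e i)%:E) ->
  forall s, uniq s ->
  \int[P]_w (\prod_(i <- s) h i (f i w))%:E = (\prod_(i <- s) e i)%:E.
Proof.
move=> indf mh h0 he s us.
have e0 i : (0 <= e i)%R.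
  by rewrite -lee_fin -he integral_ge0// => w _; rewrite lee_fin.
have mhf i : measurable_fun setT (fun w => h i (f i w)).
  exact: measurableT_comp.
have mp (E : I -> set T') j : measurable (E j) -> measurable (f j @^-1` E j).
  by move=> mE; exact: measurable_funPTI.
(* The events indexed by [s2] are traded one at a time for the functions
   indexed by [s1]. *)
suff gen s1 : forall s2 E, uniq (s1 ++ s2) -> (forall i, measurable (E i)) ->
    \int[P]_(w in \bigcap_(j in [set` s2]) f j @^-1` E j)
      (\prod_(i <- s1) h i (f i w))%:E
    = (\prod_(i <- s1) e i)%:E * \prod_(j <- s2) P (f j @^-1` E j).
  have := gen s [::] (fun=> setT).
  rewrite cats0 us big_nil mule1 => /(_ isT (fun=> measurableT)) <-.
  by congr integral; rewrite set_nil bigcap_set0.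
elim: s1 => [|i s1 IH] s2 E /=.
  move=> us2 mE; rewrite big_nil mul1e -indf//; last first.
    by move=> i _; exists (E i) => //; rewrite setTI.
  under eq_integral do rewrite big_nil.
  rewrite integral_cst ?mul1e//.
  by apply: fin_bigcap_measurable => // j _; exact: mp.
rewrite mem_cat negb_or -andbA => /and3P[is1 is2 us12] mE.
set D := \bigcap_(j in _) _.
have mD : measurable D by apply: fin_bigcap_measurable => // j _; exact: mp.
(* Everything except the factor of [i] goes into the weight. Weighted by [Z], the law of [f i] is
   [c] times its distribution, where [c] is the total mass of [Z] according to the induction
   hypothesis. *)
pose Z w := (\1_D w * \prod_(j <- s1) h j (f j w))%R.
have Z0 w : (0 <= Z w)%R by rewrite mulr_ge0// prodr_ge0.
have mZ : measurable_fun setT Z.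
  by apply: measurable_funM => //; exact: measurable_prod.
pose c := (\prod_(i <- s1) e i * fine (\prod_(j <- s2) P (f j @^-1` E j)))%R.
have c0 : (0 <= c)%R.
  by rewrite mulr_ge0 ?prodr_ge0// fine_ge0// prode_ge0.
have cE : c%:E = (\prod_(i <- s1) e i)%:E * \prod_(j <- s2) P (f j @^-1` E j).
  rewrite EFinM fineK//; apply: prode_fin_num => j _.
  by rewrite fin_num_measure//; exact: mp.
transitivity (\int[P]_w ((Z w)%:E * (h i (f i w))%:E)).
  rewrite [LHS]integral_mkcond; apply: eq_integral => w _.
  rewrite epatch_indic big_cons -!EFinM /Z; congr EFin; ring.
rewrite (@ge0_integral_weighted _ _ _ _ _ _
  (mscale (NngNum c0) (distribution P (f i))) _ _ (fun y => (h i y)%:E))//.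
- rewrite ge0_integral_mscale//=.
  + rewrite cE ge0_integral_distribution//=.
    * by rewrite he big_cons EFinM muleC muleA.
    * exact/measurable_EFinP.
    * by move=> y; rewrite lee_fin.
  + exact/measurable_EFinP.
  + by move=> y _; rewrite lee_fin.
- exact/measurable_EFinP.
- by move=> y; rewrite lee_fin.
- move=> B mB; transitivity (c%:E * P (f i @^-1` B)) => //; rewrite cE.
  (* The event that [f i] lies in [B] joins those indexed by [s2], so the induction hypothesis for
     [i :: s2] computes the weighted law. *)
  pose E' j := if j == i then B else E j.
  have E'E j : j \in s2 -> E' j = E j.
    by rewrite /E'; case: eqVneq => // -> /(negP is2).
  have mE' j : measurable (E' j) by rewrite /E'; case: ifP.
  transitivity (\int[P]_(w in \bigcap_(j in [set` i :: s2]) f j @^-1` E' j)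
      (\prod_(i <- s1) h i (f i w))%:E).
    rewrite [LHS]integral_mkcond [RHS]integral_mkcond.
    apply: eq_integral => w _.
    rewrite (_ : \bigcap_(j in _) _ = f i @^-1` B `&` D).
      by rewrite !epatch_indic indicI/= -!EFinM /Z; congr EFin; ring.
    apply/seteqP; split => [x Dx|x [Bx Dx] j /=].
      split.
        by have := Dx i; rewrite /E' eqxx; apply; rewrite /= mem_head.
      move=> j js2; rewrite -E'E//; apply: Dx.
      by rewrite /= in_cons [X in _ || X]js2 orbT.
    rewrite in_cons /E'; case: eqVneq => [->//|_ /= js2]; exact: Dx.
  rewrite IH//; last first.
    by rewrite -cat1s uniq_catCA cat1s /= mem_cat negb_or is1 is2.
  rewrite big_cons {1}/E' eqxx muleA muleAC; congr (_ * _ * _).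
  by apply: eq_big_seq => j /E'E ->.
Qed.
End independence.

(** * Transforms of the Poisson and exponential laws *)

Section laws.
Context d (T : measurableType d) (R : realType) (P : probability T R).
Local Open Scope ereal_scope.

Lemma poisson_pgf (M : {mfun T >-> nat}) (m c : R) :
  (0 <= m)%R -> (0 <= c)%R ->
  (forall U, P (M @^-1` U) = poisson_prob m 0%N U) ->
  \int[P]_w (c ^+ M w)%:E = (expR (- (m * (1 - c))))%:E.
Proof.
move=> m0 c0 PM.
rewrite -(@ge0_integral_distribution _ _ _ _ _ _ M
  (fun n => (c ^+ n)%:E))//; last first.
  by move=> n; rewrite lee_fin exprn_ge0.
rewrite (eq_measure_integral (poisson_prob m 0%N)); last first.
  by move=> A _ _; exact: PM.
(* A zero mean is treated apart, since [poisson_prob] is then defined as a Dirac mass and not by its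
   mass function. *)
move: m0; rewrite le_eqVlt => /predU1P[<-|m0].
  rewrite (eq_measure_integral (@dirac _ nat 0%N R)); last first.
    by move=> A _ _; rewrite /= /poisson_prob ltxx.
  by rewrite integral_dirac//= diracT mul1e expr0 mul0r oppr0 expR0.
(* Writing the law as a series of weighted Dirac masses turns the integral into the exponential
   series of [m * c], up to the factor [expR (- m)]. *)
pose pm n := mscale (NngNum (poisson_pmf_ge0 m n)) (@dirac _ nat n R).
rewrite (eq_measure_integral (mseries pm 0%N)); last first.
  move=> A _ _; rewrite /= /poisson_prob m0 esum_mkcond -nneseries_esumT.
    apply: eq_eseriesr => k _; rewrite /pm /= /mscale /= diracE.
    by case: ifP => _; rewrite ?mule1 ?mule0.
  by move=> k; case: ifP => // _; rewrite lee_fin poisson_pmf_ge0.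
rewrite ge0_integral_measure_series//; last first.
  by move=> n _; rewrite lee_fin exprn_ge0.
transitivity (\sum_(n <oo) (expR (- m))%:E * ((m * c) ^+ n / n`!%:R)%:E).
  apply: eq_eseriesr => n _.
  rewrite ge0_integral_mscale//=; last by move=> k _; rewrite lee_fin exprn_ge0.
  rewrite integral_dirac//= diracT mul1e -!EFinM /poisson_pmf m0 exprMn.
  by congr EFin; ring.
rewrite nneseriesZl/=; last first.
  by move=> n _; rewrite lee_fin divr_ge0// exprn_ge0// mulr_ge0// ltW.
rewrite (_ : (- (m * (1 - c)) = - m + m * c)%R); last by ring.
rewrite expRD EFinM; congr (_ * _).
rewrite expRE -EFin_lim; last first.
  rewrite /pseries/=; under eq_fun do rewrite mulrC.
  exact: is_cvg_series_exp_coeff.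
apply/congr_lim/funext => n /=; rewrite /pseries/= /series/= -sumEFin.
by apply: eq_bigr => k _; rewrite mulrC.
Qed.

(** Exponential tilting: the unit-rate density times [expR (- (c * x))] is [(1 + c)^-1] times the
    density of rate [1 + c], which has mass 1. *)
Lemma exponential_laplace (F : {mfun T >-> R}) (c : R) : (0 <= c)%R ->
  (forall V, measurable V -> distribution P F V = exponential_prob 1 V) ->
  \int[P]_w (expR (- (c * F w)))%:E = ((1 + c)^-1)%:E.
Proof.
move=> c0 PF.
have c1 : (0 < 1 + c)%R by rewrite ltr_pwDl.
have mexp : measurable_fun setT (fun x : R => (expR (- (c * x)))%:E).
  apply/measurable_EFinP; apply: measurableT_comp => //.
  by apply: measurableT_comp => //; exact: mulrl_measurable.
rewrite -(@ge0_integral_distribution _ _ _ _ _ _ F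
  (fun x => (expR (- (c * x)))%:E))//.
transitivity (\int[lebesgue_measure]_x
    ((exponential_pdf 1 x)%:E * (expR (- (c * x)))%:E)).
  have H := @ge0_integral_weighted _ _ (measurableTypeR R) R R lebesgue_measure
    (distribution P F) (fun x => x) (exponential_pdf 1)
    (fun x => (expR (- (c * x)))%:E).
  apply/esym/H => //.
  - exact: measurable_exponential_pdf.
  - by move=> x; rewrite exponential_pdf_ge0.
  - by move=> B mB; rewrite /= PF.
transitivity (\int[lebesgue_measure]_x
    (((1 + c)^-1)%:E * (exponential_pdf (1 + c) x)%:E)).
  apply: eq_integral => x _; rewrite -!EFinM; congr EFin.
  have [x0|x0] := ltP x 0%R.
    by rewrite !lt0_exponential_pdf// mul0r mulr0.
  rewrite !exponential_pdfE// mulrA mulVf ?gt_eqF// !mul1r -expRD.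
  by congr expR; ring.
rewrite ge0_integralZl//.
- by rewrite integral_exponential_pdf// mule1.
- by apply/measurable_EFinP; exact: measurable_exponential_pdf.
- by move=> x _; rewrite lee_fin exponential_pdf_ge0// ltW.
- by rewrite lee_fin invr_ge0 ltW.
Qed.
End laws.

(** A preimage splits along the countably many values of [N]. This covers sums and products with a
    random number of terms. *)
Lemma measurable_random_index d d' (T : measurableType d)
    (T' : measurableType d') (N : T -> nat) (g : nat -> T -> T') :
  measurable_fun setT N -> (forall n, measurable_fun setT (g n)) ->
  measurable_fun setT (fun w => g (N w) w).
Proof.
move=> mN mg _ Y mY; rewrite setTI.
rewrite (_ : _ @^-1` Y = \bigcup_n (N @^-1` [set n] `&` g n @^-1` Y)).
  apply: bigcup_measurable => n _.
  apply: measurableI; rewrite -[X in measurable X]setTI.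
  - exact: mN.
  - exact: mg.
apply/seteqP; split => [w Yw|w [n _ [/= <-]]//].
by exists (N w).
Qed.

(** * Generating functional of the Poisson process *)

Section poisson_functional.
Context d (T : measurableType d) (R : realType) (P : probability T R).
Variables (N : {RV P >-> nat}) (X : nat -> {RV P >-> R}).
Import HBNNSimple.

Lemma measurable_count_in (B : set R) : measurable B ->
  measurable_fun setT (count_in N X B).
Proof.
move=> mB.
apply: (measurable_random_index
  (g := fun n w => \sum_(i < n) (X i w \in B))%N) => //.
elim=> [|n IH].
  by under eq_fun do rewrite big_ord0; exact: measurable_cst.
under eq_fun do rewrite big_ord_recr/=.
apply: measurable_fun_addn => //.
apply: (@measurableT_comp _ _ _ _ _ _ nat_of_bool) => //.
apply: (@measurableT_comp _ _ _ _ _ _ (fun x => x \in B)) => //.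
apply: (measurable_fun_bool true) => //=.
rewrite setTI (_ : _ @^-1` _ = B)//.
by apply/seteqP; split => x /=; [move/set_mem|move/mem_set].
Qed.

Lemma measurable_prod_points (psi : R -> R) : measurable_fun setT psi ->
  measurable_fun setT (fun w => \prod_(i < N w) psi (X i w)).
Proof.
move=> mpsi.
apply: (measurable_random_index
  (g := fun n w => \prod_(i < n) psi (X i w))) => // n.
under eq_fun do rewrite -(big_mkord xpredT (fun i => psi (X i _))).
by apply: measurable_prod => i _; exact: measurableT_comp.
Qed.

Variables (lam r : R).
Hypothesis lam0 : 0 <= lam.
Hypothesis hPPP : homogeneous_PPP N X lam r.

Let W : set R := [set` `[- r, r]%R].

Let mW : measurable W. Proof. exact: measurable_itv. Qed.

Let W_fin (B : set R) : measurable B ->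
  lebesgue_measure (B `&` W) \is a fin_num.
Proof.
move=> mB; rewrite ge0_fin_numE//.
apply: (@le_lt_trans _ _ (lebesgue_measure W)).
  by apply: le_measure; rewrite ?inE//; exact: measurableI.
rewrite /W lebesgue_measure_itv/= lte_fin.
by case: ifP => //; rewrite -EFinD ltry.
Qed.

(** Grouping the points by the fibres of [g] gives a product of powers whose exponents are
    independent Poisson counts. Their generating functions multiply, and the exponents add up to the
    integral of [g]. *)
Lemma poisson_functional_simple (g : {nnsfun R >-> R}) : (forall x, g x <= 1) ->
  (\int[P]_w (\prod_(i < N w) (1 - g (X i w)))%:E =
   (expR (- (lam * fine (\int[lebesgue_measure]_(x in W) (g x)%:E))))%:E)%E.
Proof.
move=> g1; have [law indep] := hPPP.
(* The values are listed without repetition, so that [t] is injective and the fibres [B i] are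
   pairwise disjoint. *)
have [s us rgs] : exists2 s : seq R, uniq s & range g = [set` s].
  have /finite_seqP[s rgs] : finite_set (range g) by [].
  exists (undup s); first exact: undup_uniq.
  by rewrite rgs; apply/seteqP; split => x /=; rewrite mem_undup.
have gs x : g x \in s by have : range g (g x) by []; rewrite rgs.
pose t := tnth (in_tuple s).
have tj : injective t by apply/tuple_uniqP.
pose B i : set R := g @^-1` [set t i].
have mB i : measurable (B i) by exact: measurable_funPTI.
pose C i : {mfun T >-> nat} := mfun_Sub (mem_set (measurable_count_in (mB i))).
have t01 i : 0 <= t i <= 1.
  have : range g (t i) by rewrite rgs /=; exact: (mem_tnth i (in_tuple s)).
  by case=> x _ <-; rewrite g1 fun_ge0.
have prodE w : \prod_(i < N w) (1 - g (X i w)) = \prod_i (1 - t i) ^+ C i w.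
  (* Exactly one exponent is 1, that of the fibre containing [x]; the others are 0. *)
  have E1 x : 1 - g x = \prod_i (1 - t i) ^+ (x \in B i).
    have -> : \prod_i (1 - t i) ^+ (x \in B i) =
        \prod_(y <- s) (1 - y) ^+ (g x == y).
      rewrite [RHS]big_tnth; apply: eq_bigr => i _; congr (_ ^+ nat_of_bool _).
      by apply/idP/eqP => [/set_mem//|gx]; apply/mem_set.
    rewrite (bigD1_seq (g x))//= eqxx expr1 big1 ?mulr1// => y.
    by rewrite eq_sym => /negPf ->; rewrite expr0.
  transitivity (\prod_(i < N w) \prod_j (1 - t j) ^+ (X i w \in B j)).
    by apply: eq_bigr => i _; exact: E1.
  rewrite exchange_big/=; apply: eq_bigr => i _.
  by rewrite -prodrXr.
under eq_integral do rewrite prodE.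
rewrite (@ge0_integral_prod _ _ _ _ _ P _ C (fun i k => (1 - t i) ^+ k)
  (fun i => expR (- (lam * fine (lebesgue_measure (B i `&` W)) * t i))))//.
- rewrite -expR_sum; congr (expR _)%:E.
  suff -> : (\int[lebesgue_measure]_(x in W) (g x)%:E
      = (\sum_i t i * fine (lebesgue_measure (B i `&` W)))%:E)%E.
    by rewrite /= mulr_sumr -sumrN; apply: eq_bigr => i _; ring.
  transitivity (\int[lebesgue_measure]_(x in W)
      \sum_i ((t i)%:E * (\1_(B i) x)%:E))%E.
    apply: eq_integral => x _.
    under eq_bigr do rewrite -EFinM.
    rewrite sumEFin; congr EFin.
    transitivity (\sum_(y <- s) y * (g x == y)%:R).
      rewrite (bigD1_seq (g x))//= eqxx mulr1 big1 ?addr0// => y.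
      by rewrite eq_sym => /negPf ->; rewrite mulr0.
    rewrite [LHS]big_tnth; apply: eq_bigr => i _; rewrite indicE.
    congr (_ * (nat_of_bool _)%:R).
    by apply/eqP/idP => [gx|/set_mem//]; apply/mem_set.
  rewrite ge0_integral_sum//=.
  - rewrite -sumEFin; apply: eq_bigr => i _.
    rewrite ge0_integralZl//.
    + rewrite EFinM fineK; last exact: W_fin.
      by congr (_ * _)%E; apply: integral_indic; [exact: mW|exact: mB].
    + apply/measurable_EFinP; apply: measurable_funTS.
      by apply: measurable_indic; exact: mB.
    + by case/andP: (t01 i).
  - move=> i; apply: emeasurable_funM => //.
    apply/measurable_EFinP; apply: measurable_funTS.
    by apply: measurable_indic; exact: mB.
  - by move=> i x _; rewrite mule_ge0// lee_fin; case/andP: (t01 i).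
- apply: indep => // i j _ _ [x [/= gi gj]]; apply: tj.
  by rewrite -gi -gj.
- by move=> i k; rewrite exprn_ge0// subr_ge0; case/andP: (t01 i).
- move=> i; rewrite (@poisson_pgf _ _ _ _ _
    (lam * fine (lebesgue_measure (B i `&` W))))//.
  + by congr (expR (- _))%:E; ring.
  + by rewrite mulr_ge0// fine_ge0.
  + by rewrite subr_ge0; case/andP: (t01 i).
  + by move=> U; exact: law.
- exact: index_enum_uniq.
Qed.

(** Simple functions increasing to [psi] reduce this to the previous case: the left side converges
    by dominated convergence, the products lying between 0 and 1, and the exponent by monotone
    convergence. *)
Lemma poisson_functional (psi : R -> R) : measurable_fun setT psi ->
  (forall x, 0 <= psi x <= 1) ->
  (\int[P]_w (\prod_(i < N w) (1 - psi (X i w)))%:E =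
   (expR (- (lam * fine (\int[lebesgue_measure]_(x in W) (psi x)%:E))))%:E)%E.
Proof.
move=> mpsi psi01.
have mpsiE : measurable_fun setT (EFin \o psi) by exact/measurable_EFinP.
have psi0 x : setT x -> (0 <= (EFin \o psi) x)%E.
  by move=> _; rewrite lee_fin; case/andP: (psi01 x).
pose g := nnsfun_approx measurableT mpsiE.
have cg x : g ^~ x @ \oo --> psi x.
  by have /fine_cvg := cvg_nnsfun_approx measurableT mpsiE psi0 (I : setT x).
have mg n : measurable_fun [set: R] (g n) by exact: measurable_funPT.
have ng x m n : (m <= n)%N -> g m x <= g n x.
  by move=> mn; exact/lefP/nd_nnsfun_approx.
have gpsi n x : g n x <= psi x.
  by rewrite -lee_fin /g nnsfun_approxE; exact: le_approx.
have g1 n x : g n x <= 1 by apply: le_trans (gpsi n x) _; case/andP: (psi01 x).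
have cvgL : (\int[P]_w (\prod_(i < N w) (1 - g n (X i w)))%:E)%E @[n --> \oo]
    --> (\int[P]_w (\prod_(i < N w) (1 - psi (X i w)))%:E)%E.
  apply: (@dominated_cvg _ _ _ _ _ _ _ _ (cst 1%E)) => //=.
  - move=> n; apply/measurable_EFinP.
    apply: (measurable_prod_points (psi := fun x => 1 - g n x)).
    exact: measurable_funB.
  - move=> w _; apply: cvg_EFin; first exact: nearW.
    rewrite /comp/=; apply: (@cvg_big R 'I_(N w) *%R 1 xpredT mul_continuous
      _ _ _ (fun i n => 1 - g n (X i w))).
    by move=> i _; apply: cvgB; [exact: cvg_cst|exact: cg].
  - exact: finite_measure_integrable_cst.
  - move=> n w _; rewrite /= lee_fin ger0_norm ?prodr_ge0//.
      by apply: prodr_ile1 => i _; rewrite gerBl fun_ge0 subr_ge0 g1.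
    by move=> i _; rewrite subr_ge0.
have cvgW : (\int[lebesgue_measure]_(x in W) (g n x)%:E)%E @[n --> \oo]
    --> (\int[lebesgue_measure]_(x in W) (psi x)%:E)%E.
  have -> : (\int[lebesgue_measure]_(x in W) (psi x)%:E
      = \int[lebesgue_measure]_(x in W) limn (fun n => (g n x)%:E))%E.
    apply: eq_integral => x _; apply/esym/cvg_lim => //.
    exact: (cvg_nnsfun_approx measurableT mpsiE psi0 (I : setT x)).
  apply: cvg_monotone_convergence => //.
  - by move=> n; apply/measurable_EFinP; apply: measurable_funTS; exact: mg.
  - by move=> n x _; rewrite lee_fin.
  - by move=> x _ m n mn; rewrite lee_fin; exact: ng.
(* Convergence survives [fine] because the limit is finite: [psi] is at most 1 and the window is
   bounded. *)
have int_fin : (\int[lebesgue_measure]_(x in W) (psi x)%:E)%E \is a fin_num.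
  rewrite ge0_fin_numE; last by apply: integral_ge0 => x _; exact: psi0.
  apply: (@le_lt_trans _ _ (\int[lebesgue_measure]_(x in W) (cst 1 x))%E).
    apply: ge0_le_integral => //.
    + by move=> x _; exact: psi0.
    + exact: measurable_funTS.
    + by move=> x _; rewrite lee_fin; case/andP: (psi01 x).
  by rewrite integral_cst// mul1e ltey_eq -[W]setTI W_fin.
pose e (u : R -> R) : \bar R :=
  (expR (- (lam * fine (\int[lebesgue_measure]_(x in W) (u x)%:E))))%:E%E.
have cvgR : e (g n) @[n --> \oo] --> e psi.
  apply: cvg_EFin; first exact: nearW.
  apply: continuous_cvg; first exact: continuous_expR.
  apply: cvgN; apply: cvgMr.
  by apply: fine_cvg; rewrite fineK.
have simpleE : (fun n => \int[P]_w (\prod_(i < N w) (1 - g n (X i w)))%:E)%E =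
    (fun n => e (g n)).
  by apply/funext => n; rewrite poisson_functional_simple.
rewrite simpleE in cvgL.
exact: (cvg_unique _ cvgL cvgR).
Qed.
End poisson_functional.

(** * Tonelli for an independent pair *)

Section independent_pair.
Context d (T : measurableType d) (R : realType) (P : probability T R).
Local Open Scope ereal_scope.

(** The factorisation on rectangles identifies the joint law with the product of the marginal laws,
    by uniqueness of the product measure. *)
Lemma ge0_integral_independent d1 d2 (T1 : measurableType d1)
    (T2 : measurableType d2) (Y : {mfun T >-> T1}) (Z : {mfun T >-> T2})
    (h : T1 * T2 -> \bar R) :
  (forall A B, measurable A -> measurable B ->
    P (Y @^-1` A `&` Z @^-1` B) = P (Y @^-1` A) * P (Z @^-1` B)) ->
  measurable_fun setT h -> (forall z, 0 <= h z) ->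
  \int[P]_w h (Y w, Z w) = \int[P]_w \int[P]_w' h (Y w, Z w').
Proof.
move=> YZ mh h0.
have mYZ : measurable_fun setT (fun w => (Y w, Z w)).
  exact: measurable_fun_pair.
pose V : {mfun T >-> (T1 * T2)%type} := mfun_Sub (mem_set mYZ).
transitivity (\int[distribution P V]_z h z).
  by rewrite ge0_integral_distribution.
rewrite (eq_measure_integral (distribution P Y \x distribution P Z)); last first.
  by move=> A mA _; apply/esym/product_measure_unique.
rewrite fubini_tonelli1//.
rewrite ge0_integral_distribution//=.
- apply: eq_integral => w _; rewrite /fubini_F/= ge0_integral_distribution//.
  exact: measurableT_comp.
- exact: measurable_fun_fubini_tonelli_F.
- by move=> y; apply: integral_ge0.
Qed.

(** Lets the sample point itself serve as a random element that carries only the information in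
    [G]. *)
Lemma measurable_id_g_sigma (G : set_system T) :
  G `<=` measurable ->
  measurable_fun setT (fun w : T => w : g_sigma_algebraType G).
Proof.
move=> Gm _ A mA; rewrite setTI.
suff : <<s G >> `<=` measurable by exact.
by apply: smallest_sub => //; exact: sigma_algebra_measurable.
Qed.
End independent_pair.

(** * Integrating out the marks *)

Section marked_functional.
Context d (T : measurableType d) (R : realType) (P : probability T R).
Variables (N : {RV P >-> nat}) (X F : nat -> {RV P >-> R}).
Hypothesis hF : iid_exp_marks N X F.

Lemma sigma_of_measurable d' (T' : measurableType d') (f : {mfun T >-> T'}) :
  sigma_of f `<=` measurable.
Proof. by move=> _ [B mB <-]; rewrite setTI; exact: measurable_funPTI. Qed.

(** With the points frozen, the marks are still independent unit exponentials, so the transform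
    factorises into one Laplace transform per point. *)
Lemma marked_laplace (s : R -> R) :
  measurable_fun setT s -> (forall x, 0 <= s x) ->
  (\int[P]_w (expR (- \sum_(i < N w) F i w * s (X i w)))%:E =
   \int[P]_w (\prod_(i < N w) (1 + s (X i w))^-1)%:E)%E.
Proof.
move=> ms s0; have [lawF indF indNXF] := hF.
pose G1 : set_system T := sigma_of N `|` \bigcup_i sigma_of (X i).
pose G2 : set_system T := \bigcup_i sigma_of (F i).
have G1m : G1 `<=` measurable.
  by move=> A [|[i _]]; exact: sigma_of_measurable.
have G2m : G2 `<=` measurable.
  by move=> A [i _]; exact: sigma_of_measurable.
(* Tonelli is applied on T x T, the two factors carrying the sigma-algebras of
   the points and of the marks: the law of w |-> (w, w) is then a product. *)
pose Y : {mfun T >-> g_sigma_algebraType G1} :=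
  mfun_Sub (mem_set (measurable_id_g_sigma G1m)).
pose Z : {mfun T >-> g_sigma_algebraType G2} :=
  mfun_Sub (mem_set (measurable_id_g_sigma G2m)).
have mN1 : measurable_fun (setT : set (g_sigma_algebraType G1)) (N : _ -> nat).
  by move=> _ U mU; apply: sub_sigma_algebra; left; exists U.
have mX1 i : measurable_fun (setT : set (g_sigma_algebraType G1)) (X i : _ -> R).
  by move=> _ U mU; apply: sub_sigma_algebra; right; exists i => //; exists U.
have mF2 i : measurable_fun (setT : set (g_sigma_algebraType G2)) (F i : _ -> R).
  by move=> _ U mU; apply: sub_sigma_algebra; exists i => //; exists U.
(* The points are read from the first copy of the sample point and the marks from the second. *)
pose h (z : g_sigma_algebraType G1 * g_sigma_algebraType G2) : \bar R :=
  (\prod_(i < N z.1) expR (- (s (X i z.1) * F i z.2)))%:E.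
have mh : measurable_fun setT h.
  apply/measurable_EFinP.
  pose g n (z : g_sigma_algebraType G1 * g_sigma_algebraType G2) : R :=
    \prod_(i < n) expR (- (s (X i z.1) * F i z.2)).
  have mN1' : measurable_fun setT
      (fun z : g_sigma_algebraType G1 * g_sigma_algebraType G2 => N z.1).
    exact: measurableT_comp mN1 measurable_fst.
  apply: (measurable_random_index (g := g) mN1') => n; rewrite /g.
  under eq_fun do rewrite -(big_mkord xpredT
    (fun i => expR (- (s (X i _.1) * F i _.2)))).
  apply: measurable_prod => i _; apply: measurableT_comp => //.
  apply: measurableT_comp => //; apply: measurable_funM.
    apply: measurableT_comp => //.
    exact: measurableT_comp (mX1 i) measurable_fst.
  exact: measurableT_comp (mF2 i) measurable_snd.
have h0 z : (0 <= h z)%E by rewrite lee_fin prodr_ge0// => i _; exact: expR_ge0.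
transitivity (\int[P]_w h (Y w, Z w))%E.
  apply: eq_integral => w _; rewrite /h/= -expR_sum sumrN; congr (expR (- _))%:E.
  by apply: eq_bigr => i _; rewrite mulrC.
rewrite ge0_integral_independent//.
apply: eq_integral => w _.
(* From here [w] is fixed, so [N w] and the [X i w] are constants of the inner integral. *)
rewrite /h/=.
under eq_integral do rewrite -(big_mkord xpredT
  (fun i => expR (- (s (X i w) * F i _)))).
rewrite -(big_mkord xpredT (fun i => (1 + s (X i w))^-1)).
apply: (@ge0_integral_prod _ _ _ _ _ P _ F (fun i y => expR (- (s (X i w) * y)))
  (fun i => (1 + s (X i w))^-1)) => //.
- move=> i; apply: measurableT_comp => //.
  by apply: measurableT_comp => //; exact: mulrl_measurable.
- by move=> i; apply: exponential_laplace => // V mV; exact: lawF.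
- exact: iota_uniq.
Qed.
End marked_functional.

Lemma enorm_e_x (R : realType) (x : R) : enorm (x *: e_x) = `|x|.
Proof.
rewrite /enorm big_ord_recl big_ord1 /e_x !mxE/= mulr1 mulr0 expr0n/= addr0.
by rewrite sqrtr_sqr.
Qed.

(** * The path-loss integral over the window *)

Section path_loss_integral.
Context (R : realType) (alpha : R).
Hypothesis alpha1 : 1 < alpha.
Let mu := @lebesgue_measure R.
(** The even extension of the integrand of [g_circ], which allows reflection and splitting at 0. *)
Let G (u : R) : R := (1 + `|u| `^ alpha)^-1.
Let J (a b : R) : R := Rintegral mu `[a, b] G.

Let alpha0 : 0 < alpha. Proof. exact: lt_trans alpha1. Qed.

(** Away from 0 the power is an exponential of a logarithm. At 0 it is squeezed between 0 and the
    absolute value, because [alpha] exceeds 1. *)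
Let cpow : continuous (fun u : R => `|u| `^ alpha : R).
Proof.
move=> u; have [->|u0] := eqVneq u 0.
  rewrite /continuous_at normr0 powR0 ?gt_eqF//.
  apply: (@squeeze_cvgr _ _ _ _ (fun=> 0) (fun u : R => `|u|)); last 2 first.
  - exact: cvg_cst.
  - by have := @norm_continuous R R^o 0; rewrite /continuous_at normr0.
  near=> x; rewrite powR_ge0/=.
  have [->|x0] := eqVneq x 0; first by rewrite normr0 powR0 ?gt_eqF.
  rewrite -[leRHS]powRr1//; apply: ger_powR; last exact: ltW.
  rewrite normr_gt0 x0/=; near: x.
  exact: (@nbhs0_le R R^o).
rewrite /continuous_at.
have powE : \forall x \near u, expR (alpha * ln `|x|) = `|x| `^ alpha.
  near=> x.
  have x0 : x != 0 by near: x; exact: (cvgr_neq0 (F := nbhs u) (f := id) u).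
  by rewrite /powR normr_eq0 (negPf x0).
apply: (cvg_trans (near_eq_cvg powE)).
rewrite /powR normr_eq0 (negPf u0).
apply: continuous_cvg; first exact: continuous_expR.
apply: cvgMr; apply: continuous_cvg; last exact: norm_continuous.
by apply: continuous_ln; rewrite normr_gt0.
Unshelve. all: by end_near. Qed.

Let Gp (u : R) : 0 < 1 + `|u| `^ alpha.
Proof. by rewrite ltr_pwDl// powR_ge0. Qed.

Let cG : continuous G.
Proof.
move=> u; apply: cvgV; first by rewrite gt_eqF.
by apply: cvgD; [exact: cvg_cst|exact: cpow].
Qed.

Let intG a b : mu.-integrable `[a, b] (EFin \o G).
Proof.
apply: continuous_compact_integrable; first exact: segment_compact.
exact: continuous_subspaceT.
Qed.

Let J0 (t : R) : 0 <= t -> J 0 t = g_circ alpha t.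
Proof.
move=> t0; apply: eq_Rintegral => x; rewrite inE/= in_itv/= => /andP[x0 _].
by rewrite /G ger0_norm.
Qed.

Let JD a b c : a <= b -> b <= c -> J a c = J a b + J b c.
Proof.
move=> ab bc; suff <- : J a c - J a b = J b c by rewrite addrC subrK.
rewrite /J Rintegral_itvB// Rintegral_itv_obnd_cbnd//.
by apply: integrableS (intG b c) => //; apply: subset_itvr; rewrite bnd_simp.
Qed.

Let JN (a b : R) : a <= b -> J (- b) (- a) = J a b.
Proof.
move=> ab; rewrite /J /Rintegral (@integration_by_substitution_oppr R G a b ab).
  apply: (congr1 fine); apply: eq_integral => x _.
  by rewrite /= /G normrN.
exact: continuous_subspaceT.
Qed.

Let Jaffine (z c a b : R) : 0 < z -> a <= b ->
  Rintegral mu `[a, b] (fun x => G ((x - c) / z)) =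
  z * J ((a - c) / z) ((b - c) / z).
Proof.
move=> z0 ab.
pose H (x : R^o) : R^o := (x - c) / z.
have dH : derive1 H = cst z^-1.
  apply/funext => x; rewrite derive1E /H derive_val.
  by rewrite scaler0 subr0 add0r; exact: mulr1.
have cH : continuous H.
  move=> x; apply: cvgMl; apply: cvgB; [exact: cvg_id|exact: cvg_cst].
rewrite /J.
have -> : Rintegral mu `[(a - c) / z, (b - c) / z] G =
    Rintegral mu `[a, b] (fun x => G (H x) * z^-1).
  congr fine; rewrite (@integration_by_substitution_increasing _ H)//.
  - by apply: eq_integral => x _; rewrite dH.
  - by move=> x y _ _ xy; rewrite /H ltr_pM2r ?invr_gt0// ltrD2r.
  - by rewrite dH => x _; exact: cvg_cst.
  - by rewrite dH; exact: is_cvg_cst.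
  - by rewrite dH; exact: is_cvg_cst.
  - split; first by move=> x _; exact: ex_derive.
    + exact/cvg_at_right_filter/cH.
    + exact/cvg_at_left_filter/cH.
  - exact: continuous_subspaceT.
rewrite RintegralZr//.
- by rewrite mulrCA divff ?mulr1// gt_eqF.
- apply: continuous_compact_integrable; first exact: segment_compact.
  apply: continuous_subspaceT => x.
  by apply: (continuous_comp (f := H)); [exact: cH|exact: cG].
Qed.

(** An affine substitution leaves an integral of [G] over an interval, which is expressed by
    integrals starting at 0; the two indicators of [calX] tell whether that interval contains 0. *)
Lemma Rintegral_calX (zeta x0 r : R) : 0 < zeta -> 0 < r ->
  Rintegral lebesgue_measure `[- r, r]
    (fun x => (1 + `|(x - x0) / zeta| `^ alpha)^-1) =
  zeta * calX alpha zeta (x0 *: e_x) r.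
Proof.
move=> z0 r0; rewrite -/(G _) Jaffine//; last by lra.
congr (_ * _); rewrite /calX enorm_e_x.
set c := `|x0|.
(* By evenness of [G] only the distance [c] of the receiver from the origin matters; the reflection
   is needed for [x0] nonnegative. *)
have -> : J ((- r - x0) / zeta) ((r - x0) / zeta) =
    J ((c - r) / zeta) ((c + r) / zeta).
  rewrite /c; have [x00|x00] := ger0P x0.
    rewrite -JN; last by rewrite ler_pM2r ?invr_gt0//; lra.
    by rewrite -!mulNr !opprB opprK [x0 + r]addrC.
  by rewrite [- x0 - r]addrC [- x0 + r]addrC.
have c0 : 0 <= c by exact: normr_ge0.
(* If [c <= r], the interval is split at 0 and its left part reflected. Otherwise both ends are
   positive and the integral is a difference. *)
have [cr|rc] := leP c r.
  rewrite mulr1 mulr0 subr0 (@JD _ 0).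
  - rewrite -{1}oppr0 (_ : (c - r) / zeta = - ((r - c) / zeta)); last first.
      by rewrite -mulNr opprB.
    rewrite JN; last by rewrite divr_ge0 ?(ltW z0)// subr_ge0.
    rewrite !J0; first by rewrite addrC [c + r]addrC.
    + by rewrite divr_ge0 ?(ltW z0)// subr_ge0.
    + by rewrite divr_ge0 ?(ltW z0)//; lra.
  - by rewrite pmulr_lle0 ?invr_gt0// subr_le0.
  - by rewrite divr_ge0 ?(ltW z0)//; lra.
rewrite mulr0 addr0 mulr1 -mulNr opprB -!J0; last 2 first.
- by rewrite divr_ge0 ?(ltW z0)//; lra.
- by rewrite divr_ge0 ?(ltW z0)//; lra.
rewrite [r + c]addrC (@JD 0 ((c - r) / zeta) ((c + r) / zeta)).
- by rewrite addrAC subrr add0r.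
- by rewrite divr_ge0 ?(ltW z0)//; lra.
- by rewrite ler_pM2r ?invr_gt0//; lra.
Qed.
End path_loss_integral.

(** * Positivity and horizontal form of the path loss *)

Section urban_path_loss.
Context (R : realType).

Lemma enorm_gt0 (v : 'cV[R]_2) : v != 0 -> 0 < enorm v.
Proof.
move=> v0; rewrite sqrtr_gt0 lt_neqAle sumr_ge0 ?andbT; last first.
  by move=> i _; exact: sqr_ge0.
rewrite eq_sym psumr_eq0; last by move=> i _; exact: sqr_ge0.
apply: contra v0 => /allP v0; apply/eqP/colP => i; rewrite mxE.
by have := v0 i (mem_index_enum _); rewrite sqrf_eq0 => /eqP.
Qed.

(** The base of each power is positive: by the threshold [Delta] in the first formula, by [x <> xrx]
    in the other two. *)
Lemma urban_path_loss_gt0 (alpha A A' Delta : R) (x xrx : 'cV[R]_2) :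
  0 < A -> 0 < A' -> 0 < Delta -> x <> xrx ->
  0 < urban_path_loss alpha A A' Delta x xrx.
Proof.
move=> A0 A'0 D0 xxrx; rewrite /urban_path_loss.
have enorm0 v : 0 <= enorm v :> R by exact: sqrtr_ge0.
case: ifPn => _; last first.
  by rewrite mulr_gt0// powR_gt0// enorm_gt0// subr_eq0; apply/eqP => /esym.
case: ifPn => [|_].
  rewrite lt_min => /andP[Dx Dxrx]; rewrite mulr_gt0// powR_gt0// mulr_gt0//.
    apply: enorm_gt0; apply: contraTneq Dx => ->.
    by rewrite mxE normr0 -leNgt ltW.
  exact: lt_trans Dxrx.
rewrite mulr_gt0// powR_gt0//.
have [x0|x0] := eqVneq x 0; last by rewrite ltr_wpDr// enorm_gt0.
rewrite ltr_wpDl// enorm_gt0//; apply/eqP => xrx0; apply: xxrx.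
by rewrite x0 xrx0.
Qed.

(** Only the origin falls in the vertical branch; there the minimum is at most 0, hence below
    [Delta], and the second formula agrees with the third. *)
Lemma urban_path_loss_horizontal (alpha A A' Delta x y : R) : 0 < Delta ->
  urban_path_loss alpha A A' Delta (x *: e_x) (y *: e_x) =
  A * `|x - y| `^ (- alpha).
Proof.
move=> D0; rewrite /urban_path_loss -scalerBl !enorm_e_x distrC.
have -> : (x *: e_x : 'cV[R]_2) 0 0 = x by rewrite !mxE /= mulr1.
have -> : (x *: e_x : 'cV[R]_2) 1 0 = 0 by rewrite !mxE /= mulr0.
case: eqVneq => // ->.
by rewrite normr0 add0r sub0r normrN lt_min ltNge (ltW D0).
Qed.
End urban_path_loss.

(** * The transform of the interference from the horizontal road *)

Theorem proposition3 (R : realType)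
    (d : measure_display) (T : measurableType d) (P : probability T R)
    (N : {RV P >-> nat}) (X F : nat -> {RV P >-> R})
    (alpha beta A A' Delta Rx lambdax pI x_rx x_tx y_tx : R)
    (halpha : 1 < alpha) (hbeta : 0 < beta) (hA : 0 < A) (hA' : 0 < A')
    (hDelta : 0 < Delta) (hRx : Delta <= Rx) (hlambda : 0 < lambdax)
    (hpI : 0 <= pI <= 1)
    (htx : x_tx * y_tx = 0)
    (hne : x_tx *: e_x + y_tx *: e_y <> x_rx *: e_x :> 'cV[R]_2)
    (hPPP : homogeneous_PPP N X (pI * lambdax) Rx)
    (hF : iid_exp_marks N X F) :
  let xrx : 'cV[R]_2 := x_rx *: e_x in
  let xtx : 'cV[R]_2 := x_tx *: e_x + y_tx *: e_y in
  let lpl := urban_path_loss alpha A A' Delta in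
  let zeta := (A * beta / lpl xtx xrx) `^ alpha^-1 in
  P_circ N X beta F lpl xtx xrx
  = (expR (- (pI * lambdax * zeta * calX alpha zeta xrx Rx)))%:E.
Proof.
move=> xrx xtx lpl zeta.
pose K := A * beta / lpl xtx xrx.
have lpl0 : 0 < lpl xtx xrx by exact: urban_path_loss_gt0.
have K0 : 0 < K by rewrite !(mulr_gt0, invr_gt0).
have alpha0 : 0 < alpha by exact: lt_trans halpha.
have zeta0 : 0 < zeta by exact: powR_gt0.
have zetaE : zeta `^ alpha = K.
  by rewrite -powRrM mulVf ?gt_eqF// powRr1// ltW.
have zetaVE : zeta^-1 `^ alpha = K^-1.
  by rewrite -zetaE -(powR_inv1 (ltW zeta0)) -powRrM mulN1r powRN.
have lam0 : 0 <= pI * lambdax.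
  by rewrite mulr_ge0 ?(ltW hlambda)//; case/andP: hpI.
(* This is [beta'] times the path loss from [x], the argument at which the Laplace transform of a
   mark is taken. *)
pose s x : R := K * `|x - x_rx| `^ (- alpha).
have sE x : beta / lpl xtx xrx * lpl (x *: e_x) xrx = s x.
  by rewrite /lpl urban_path_loss_horizontal// /s /K; ring.
have s0 x : 0 <= s x by rewrite mulr_ge0 ?powR_ge0// ltW.
have ms : measurable_fun setT s.
  apply: measurable_funM => //.
  apply: (measurableT_comp (measurable_powR _)) => //.
  by apply: measurableT_comp => //; exact: measurable_funB.
have s1 x : 0 < 1 + s x by rewrite ltr_pwDl.
pose psi x : R := 1 - (1 + s x)^-1.
(* Since [K] is [zeta] to the power [alpha], [s x] is the inverse of the power [v] on the right, and
   1 - 1 / (1 + 1 / v) = 1 / (1 + v). *)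
have psiE x : x != x_rx -> psi x = (1 + `|(x - x_rx) / zeta| `^ alpha)^-1.
  move=> xx; rewrite /psi /s normrM powRM// normfV (gtr0_norm zeta0).
  have p0 : 0 < `|x - x_rx| `^ alpha by rewrite powR_gt0// normr_gt0 subr_eq0.
  rewrite zetaVE powRN; field.
  by rewrite !gt_eqF// addr_gt0.
have psi01 x : 0 <= psi x <= 1.
  by rewrite /psi subr_ge0 invf_le1// lerDl s0/= gerBl invr_ge0 ltW.
have mpsi : measurable_fun setT psi.
  apply: measurable_funB => //.
  under eq_fun do rewrite -powR_inv1 ?(ltW (s1 _))//.
  apply: (measurableT_comp (measurable_powR _)) => //.
  exact: measurable_funD.
rewrite /P_circ expectation.unlock.
transitivity (\int[P]_w (expR (- \sum_(i < N w) F i w * s (X i w)))%:E)%E.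
  apply: eq_integral => w _; congr (expR _)%:E.
  rewrite /interference mulNr mulr_sumr; congr (- _); apply: eq_bigr => i _.
  by rewrite -sE; ring.
rewrite (marked_laplace hF ms s0).
transitivity (\int[P]_w (\prod_(i < N w) (1 - psi (X i w)))%:E)%E.
  apply: eq_integral => w _; congr EFin; apply: eq_bigr => i _.
  by rewrite /psi subKr.
rewrite (poisson_functional lam0 hPPP mpsi psi01).
congr (expR (- _))%:E; rewrite -[RHS]mulrA; congr (_ * _).
rewrite -Rintegral_calX//; last exact: lt_le_trans hRx.
rewrite /Rintegral; apply: (congr1 fine).
(* At [x_rx] itself [powR] makes [s], hence [psi], vanish, whereas the integrand
   of [calX] is 1 there. *)
have mD : measurable (`[- Rx, Rx]%classic `\ x_rx : set R).
  exact: measurableD.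
have mpsiD : measurable_fun (`[- Rx, Rx]%classic `\ x_rx) (fun x => (psi x)%:E).
  by apply: measurable_funTS; exact/measurable_EFinP.
have psiED : {in `[- Rx, Rx]%classic `\ x_rx, (fun x => (psi x)%:E) =1
    (fun x => ((1 + `|(x - x_rx) / zeta| `^ alpha)^-1)%:E)}.
  by move=> x; rewrite inE => -[_ /eqP/psiE ->].
rewrite -(@integral_setD1 _ _ x_rx)//.
rewrite -[RHS](@integral_setD1 _ _ x_rx)//.
- exact: eq_integral.
- exact: eq_measurable_fun mpsiD.
Qed.
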